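(* Let $A,B\in\mathbb{Z}$ satisfy $|A|\leq B$ and $2|A|\geq B+3$, and let $T$ be the tile defined below. Then $T$ is not disk-like.
   Context: Let $a(x,y)=(x+1,y)$ and $c(x,y)=(-x,-y)$. Let $g(\mathbf{x})=\begin{pmatrix}0&-B\\1&-A\end{pmatrix}\mathbf{x}+\left(\frac{B-1}{2},0\right)^T$, $\mathcal{D}=\{id,a,\dots,a^{B-2},c\}$ (note $B\geq 3$ under the hypotheses), and let $T$ be the unique nonempty compact set with $g(T)=\bigcup_{\delta\in\mathcal{D}}\delta(T)$. Disk-like means homeomorphic to a closed disk. *)

(* Defs.v *)
From HB Require Import structures.
From mathcomp Require Import all_boot all_order all_algebra.
From mathcomp Require Import all_classical all_reals all_analysis.
Set Implicit Arguments. Unset Strict Implicit. Unset Printing Implicit Defensive.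
Import Order.TTheory GRing.Theory Num.Theory.
Import numFieldNormedType.Exports.
Local Open Scope classical_set_scope.
Local Open Scope ring_scope.

Definition tile_a {R : realType} (p : R * R) : R * R := (p.1 + 1, p.2).
Definition tile_c {R : realType} (p : R * R) : R * R := (- p.1, - p.2).

(* g(x) = [[0,-B],[1,-A]] x + ((B-1)/2, 0) *)
Definition tile_g {R : realType} (A B : int) (p : R * R) : R * R :=
  (- (B%:~R) * p.2 + (B%:~R - 1) / 2, p.1 - (A%:~R) * p.2).

Definition tile_equation {R : realType} (A B : int) (T : set (R * R)) : Prop :=
  tile_g A B @` T =
    (\bigcup_(k in [set k : nat | (k <= `|B| - 2)%N]) (iter k tile_a @` T))
    `|` (tile_c @` T).

Definition closed_disk {R : realType} : set (R * R) :=
  [set p | p.1 ^+ 2 + p.2 ^+ 2 <= 1].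

Definition homeomorphic_sets {R : realType} (S D : set (R * R)) : Prop :=
  exists (f h : R * R -> R * R),
    [/\ {within S, continuous f}, {within D, continuous h},
        f @` S `<=` D, h @` D `<=` S &
        (forall x, S x -> h (f x) = x) /\ (forall y, D y -> f (h y) = y)].

Definition disk_like {R : realType} (T : set (R * R)) : Prop :=
  homeomorphic_sets T closed_disk.

(* Main.v *)
(** A closed disk stays connected when a countable set is removed, so it is
    enough to cut [T] along a countable set.  Expanding by [g] and undoing a
    digit makes [T] the set of points having an infinite digit expansion.  Fix a
    digit [k] near the middle and let [e] be the corresponding expansion: a point
    of [T] is either one of the countably many (in fact at most one) points whose
    expansion is [k, k, k, ...], or its first digit different from [k] lies on one
    side or the other of [k].  This splits [T] into two pieces (when [A > 0] the
    two sides are exchanged at every step, since the matrix of [g] then reverses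
    the order of the subtiles), and one has to see that the pieces share only
    countably many points.

    Two points of [T] related by [p = s q + (x, y)], with [s = 1] or [-1] and
    [x, y] integers, expand to points related in the same way, and [y] is bounded
    by the height of [T].  When the matrix of [g] has real eigenvalues,
    [(B - |A| + 1) |y| <= B - 1], and with [2 |A| >= B + 3] this leaves no common
    point at all once [B >= 6].  For the five remaining pairs [(|A|, B)] the finite
    automaton of relations is explored by computation. *)

Require Import Defs.
From HB Require Import structures.
From mathcomp Require Import all_boot all_order all_algebra.
From mathcomp Require Import all_classical all_reals all_analysis.
From mathcomp Require Import ring lra zify.
Import Order.TTheory GRing.Theory Num.Theory.
Import numFieldNormedType.Exports.
Local Open Scope classical_set_scope.
Local Open Scope ring_scope.

(** * Countable sets do not separate a disk *)

Lemma countable_setU (T : Type) (A B : set T) :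
  countable A -> countable B -> countable (A `|` B).
Proof.
move=> cA cB; rewrite -bigcup2inE.
apply: bigcup_countable => [|[|[|i]]] // _; exact: countableP.
Qed.

Lemma countable_preimage (T U : Type) (f : T -> U) (A : set U) :
  injective f -> countable A -> countable (f @^-1` A).
Proof.
move=> fI /countable_injP[g gI]; apply/countable_injP; exists (g \o f).
move=> x y; rewrite !inE => Ax Ay /= e; apply: fI; apply: gI => //; exact/mem_set.
Qed.

Lemma uncountable_itv (R : realType) (a b : R) : a < b ->
  ~ countable ([set` `[a, b]] : set R).
Proof.
move=> ab /countable_lebesgue_measure0; rewrite lebesgue_measure_itv /= lte_fin ab.
by rewrite -EFinB => /eqP; rewrite eqe subr_eq0 gt_eqF.
Qed.

Definition line_pt {R : realType} (u w : R * R) (t : R) : R * R :=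
  (u.1 + t * (w.1 - u.1), u.2 + t * (w.2 - u.2)).

Definition segment {R : realType} (u w : R * R) : set (R * R) :=
  line_pt u w @` `[0, 1].

Lemma connected_segment (R : realType) (u w : R * R) : connected (segment u w).
Proof.
apply: connected_continuous_connected; first exact: segment_connected.
apply: continuous_subspaceT => t.
have h (a b : R) : (fun t => a + t * b) @ t --> a + t * b.
  by apply: cvgD; [exact: cvg_cst | apply: cvgM; [exact: cvg_id | exact: cvg_cst]].
exact: (cvg_pair (h u.1 (w.1 - u.1)) (h u.2 (w.2 - u.2))).
Qed.

Lemma segment_disk (R : realType) (u w : R * R) :
  closed_disk u -> closed_disk w -> segment u w `<=` closed_disk.
Proof.
move=> hu hw _ [t /= t01 <-]; move: t01; rewrite in_itv /= => /andP[t0 t1].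
rewrite /closed_disk /= in hu hw *.
set a := u.1 in hu *; set b := u.2 in hu *; set c := w.1 in hw *; set d := w.2 in hw *.
(* [h1], [h2] and [h3] add up to [1 - |(1 - t) u + t w|^2]: the squared norm is convex. *)
have h1 : 0 <= (1 - t) * (1 - (a ^+ 2 + b ^+ 2)) by rewrite mulr_ge0 ?subr_ge0.
have h2 : 0 <= t * (1 - (c ^+ 2 + d ^+ 2)) by rewrite mulr_ge0 ?subr_ge0.
have h3 : 0 <= t * (1 - t) * ((a - c) ^+ 2 + (b - d) ^+ 2).
  by rewrite mulr_ge0 ?addr_ge0 ?sqr_ge0 // mulr_ge0 ?subr_ge0.
nra.
Qed.

Lemma segment_l (R : realType) (u w : R * R) : segment u w u.
Proof.
exists 0; rewrite /= ?in_itv /= ?lexx ?ler01 //.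
by rewrite /line_pt !mul0r !addr0 -surjective_pairing.
Qed.

Lemma segment_r (R : realType) (u w : R * R) : segment u w w.
Proof.
exists 1; rewrite /= ?in_itv /= ?lexx ?ler01 // /line_pt !mul1r.
by rewrite ![_ + (_ - _)]addrC !subrK -surjective_pairing.
Qed.

(* For [z <> u] the line through [u] and [z] meets the horizontal line [y = c]
   in a single point, so each point of [C] spoils at most one [s]. *)
Lemma countable_blocked (R : realType) (u : R * R) (c : R) (C : set (R * R)) :
  countable C -> ~ C u -> u.2 != c ->
  countable [set s : R | segment u (s, c) `&` C !=set0].
Proof.
move=> cC Cu uc.
pose F (z : R * R) := u.1 + (z.1 - u.1) * (c - u.2) / (z.2 - u.2).
apply: (sub_countable _ (B := F @` C)); last first.
  apply: sub_countable cC; exact: card_image_le.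
apply: subset_card_le => s /= [z [[t _ zE] Cz]]; exists z => //.
have cu : c - u.2 != 0 by rewrite subr_eq0 eq_sym.
have t0 : t != 0.
  apply/eqP => t0; apply: Cu; rewrite (_ : u = z) // -zE t0 /line_pt !mul0r !addr0.
  exact: surjective_pairing.
rewrite /F -zE /line_pt /=.
field.
by rewrite [X in X != 0]addrAC subrr add0r mulf_neq0.
Qed.

(** Join [u] and [v] through a point of a horizontal line containing neither. Each segment meets [C]
    for only countably many positions of that point, while the available positions fill an
    interval. *)
Lemma disk_minus_countable (R : realType) (C : set (R * R)) (u v : R * R) :
  countable C -> closed_disk u -> closed_disk v -> ~ C u -> ~ C v ->
  exists K, [/\ connected K, K `<=` closed_disk, K u, K v & K `&` C = set0].
Proof.
move=> cC Du Dv Cu Cv.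
(* Three candidate heights against two forbidden ones; staying in [[0, 1/2]] keeps [(s, c)] in the
   disk. *)
have [c [c0 c12 uc vc]] : exists c : R, [/\ 0 <= c, c <= 1/2, u.2 != c & v.2 != c].
  have [|n1] := boolP ((u.2 != 0) && (v.2 != 0)).
    by move=> /andP[h1 h2]; exists 0; split => //; lra.
  have [|n2] := boolP ((u.2 != 1/4) && (v.2 != 1/4)).
    by move=> /andP[h1 h2]; exists (1/4); split => //; lra.
  exists (1/2); split; try lra.
  - apply/eqP => e; move: n1 n2; rewrite e !negb_and !negbK.
    move=> /orP[/eqP h|/eqP ->] /orP[/eqP h'|/eqP h']; lra.
  - apply/eqP => e; move: n1 n2; rewrite e !negb_and !negbK.
    move=> /orP[/eqP ->|/eqP h] /orP[/eqP h'|/eqP h']; lra.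
have cB := countable_setU _ _ _ (countable_blocked _ _ _ _ cC Cu uc)
                           (countable_blocked _ _ _ _ cC Cv vc).
have [s [s01 sB]] : exists s : R, s \in `[0, 1/2] /\
    ~ ([set s | segment u (s, c) `&` C !=set0] `|`
       [set s | segment v (s, c) `&` C !=set0]) s.
  apply: contrapT => hno; apply: (@uncountable_itv R 0 (1/2)); first lra.
  apply: sub_countable cB; apply: subset_card_le => s hs.
  by apply: contrapT => h; apply: hno; exists s.
have Dw : closed_disk (s, c).
  by move: s01; rewrite in_itv /= => /andP[s0 s1]; rewrite /closed_disk /=; nra.
exists (segment u (s, c) `|` segment v (s, c)); split.
- apply: connectedU; [|exact: connected_segment|exact: connected_segment].
  by exists (s, c); split; exact: segment_r.
- by move=> p [] /segment_disk; apply.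
- by left; exact: segment_l.
- by right; exact: segment_l.
- apply/seteqP; split => // p [[pK|pK] Cp]; apply: sB; [left|right]; by exists p.
Qed.

Lemma disk_like_minus_countable (R : realType) (T Z : set (R * R)) (x y : R * R) :
  disk_like T -> countable Z -> T x -> T y -> ~ Z x -> ~ Z y ->
  exists K, [/\ connected K, K `<=` T, K x, K y & K `&` Z = set0].
Proof.
move=> [f [h [_ hc fT hD [hf fh]]]] cZ Tx Ty Zx Zy.
have fD p : T p -> closed_disk (f p) by move=> Tp; apply: fT; exists p.
have hT q : closed_disk q -> T (h q) by move=> Dq; apply: hD; exists q.
pose C := f @` (T `&` Z).
have cC : countable C.
  apply: (sub_countable _ (B := T `&` Z)); first exact: card_image_le.
  by apply: sub_countable cZ; apply: subset_card_le => p [].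
have nC p : T p -> ~ Z p -> ~ C (f p).
  by move=> Tp Zp [q [Tq Zq] e]; apply: Zp; rewrite -(hf _ Tp) -e hf.
have [K [Kc KD Ku Kv KC]] := disk_minus_countable _ _ _ _ cC (fD _ Tx) (fD _ Ty)
                               (nC _ Tx Zx) (nC _ Ty Zy).
exists (h @` K); split.
- apply: connected_continuous_connected => //.
  exact: continuous_subspaceW hc.
- by move=> _ [q Kq <-]; exact/hT/KD.
- by exists (f x) => //; exact: hf.
- by exists (f y) => //; exact: hf.
- apply/seteqP; split => // _ [[q Kq <-] Zq].
  have : (K `&` C) q; last by rewrite KC.
  by split => //; exists (h q); [split => //; exact/hT/KD | rewrite fh //; exact: KD].
Qed.

Lemma disk_like_uncountable (R : realType) (T : set (R * R)) :
  disk_like T -> ~ countable T.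
Proof.
move=> [f [h [_ _ fT hD [hf fh]]]] cT.
apply: (@uncountable_itv R 0 1) => //.
have hT (s : R) : s \in `[0, 1] -> closed_disk (s, 0).
  rewrite in_itv /closed_disk /= => /andP[s0 s1]; nra.
have cT' : countable (h @^-1` T `&` closed_disk).
  have /countable_injP[g gI] := cT.
  apply/countable_injP; exists (g \o h) => p q; rewrite !inE => -[Tp Dp] [Tq Dq] /= e.
  rewrite -(fh _ Dp) -(fh _ Dq); congr f; apply: gI => //; exact/mem_set.
have : countable [set s : R | (h @^-1` T `&` closed_disk) (s, 0)].
  apply: (countable_preimage _ _ (fun s : R => (s, 0 : R)) _ _ cT') => s t [] //.
apply: sub_countable; apply: subset_card_le => s s01 /=; split; last exact: hT.
by apply: hD; exists (s, 0) => //; exact: hT.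
Qed.

(** * Cutting a disk-like set along the orbits of a map *)

Section Cut.
Context (R : realType) (T Z : set (R * R)) (e : R * R -> R * R).
Context (ce : continuous e) (Tcl : closed T) (eT : forall p, T (e p) -> T p).
Context (Zforever : forall p, (forall n, T (iter n e p)) -> Z p).

Lemma iter_in_le (n m : nat) (p : R * R) :
  (n <= m)%N -> T (iter m e p) -> T (iter n e p).
Proof.
move=> /subnKC <-; elim: (m - n)%N => [|k IH]; first by rewrite addn0.
by rewrite addnS iterS => /eT.
Qed.

Lemma continuous_iter (n : nat) : continuous (iter n e).
Proof.
elim: n => [|n IH] p; first exact: cvg_id.
exact: (continuous_comp (IH p) (ce _)).
Qed.

(** The target depends on the time [n] because the two sides may be exchanged at each expansion. *)
Definition eventually_in (P : nat -> set (R * R)) : set (R * R) :=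
  [set p | exists n, P n (iter n e p)].

Section TwoSides.
Context (P Q : nat -> set (R * R)).
Context (Qcl : forall n, closed (Q n)) (QT : forall n, Q n `<=` T).
Context (cover : forall n p, T p -> [\/ P n p, Q n p | T (e p)]).
Context (PQZ : eventually_in P `&` eventually_in Q `<=` Z).

Lemma eventually_cover (p : R * R) :
  T p -> ~ Z p -> eventually_in P p \/ eventually_in Q p.
Proof.
move=> Tp Zp; apply: contrapT => h; apply: Zp; apply: Zforever.
elim=> [//|n IH]; case: (cover n _ IH) => [Pn|Qn|//]; exfalso; apply: h.
  by left; exists n.
by right; exists n.
Qed.

(** Outside [Z] every point leaves [T] at some time, and for good. So a point of [K] is in
    [eventually_in P] exactly when it is out of [T] at some time [n] without having entered [Q m]
    for any [m < n], which is an open condition. *)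
Lemma eventually_open (K : set (R * R)) : K `<=` T -> K `&` Z = set0 ->
  exists2 U, open U & K `&` eventually_in P = K `&` U.
Proof.
move=> KT KZ; have nZ p : K p -> ~ Z p.
  by move=> Kp Zp; suff : (K `&` Z) p by rewrite KZ.
pose V m := ~` (iter m e @^-1` Q m).
exists (\bigcup_n ((~` (iter n e @^-1` T)) `&` \bigcap_(m in `I_n) V m)).
  apply: bigcup_open => n _; apply: openI.
    apply: closed_openC; apply: preimage_closed => // ? _; exact: continuous_iter.
  have -> : \bigcap_(m in `I_n) V m = \big[setI/setT]_(m < n) V m.
    by rewrite bigcap_mkord.
  elim/big_ind: _ => [|A B oA oB|m _]; [exact: openT|exact: openI|].
  apply: closed_openC; apply: preimage_closed => // ? _; exact: continuous_iter.
apply/seteqP; split => p [Kp]; move: (nZ _ Kp) => Zp.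
  move=> Pp; split => //.
  have [n nT] : exists n, ~ T (iter n e p).
    apply: contrapT => h; apply: Zp; apply: Zforever => n.
    by apply: contrapT => h'; apply: h; exists n.
  by exists n => //; split => // m _ Qm; apply: Zp; apply: PQZ; split=> //; exists m.
move=> [n _ [nT nQ]]; split => //.
have [//|[m Qm]] := eventually_cover _ (KT _ Kp) Zp.
have [mn|nm] := ltnP m n; first by case: (nQ m mn).
by exfalso; apply: nT; apply: (iter_in_le _ _ _ nm); exact: QT Qm.
Qed.

End TwoSides.

(** Join a point of [P 0] to a point of [Q 0] by a connected [K] inside [T] avoiding [Z]. The two
    eventual sets cover [K], are disjoint on it and are both relatively open. *)
Lemma disk_like_cut (P Q : nat -> set (R * R)) : disk_like T -> countable Z ->
  (forall n, closed (P n)) -> (forall n, closed (Q n)) ->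
  (forall n, P n `<=` T) -> (forall n, Q n `<=` T) ->
  (forall n p, T p -> [\/ P n p, Q n p | T (e p)]) ->
  eventually_in P `&` eventually_in Q `<=` Z ->
  ~ countable (P 0%N) -> ~ countable (Q 0%N) -> False.
Proof.
move=> dT cZ Pcl Qcl PT QT cover PQZ cP cQ.
have pick A : ~ countable A -> exists x, A x /\ ~ Z x.
  move=> cA; apply: contrapT => h; apply: cA; apply: sub_countable cZ.
  apply: subset_card_le => x Ax; apply: contrapT => Zx; apply: h; by exists x.
have [x [Px Zx]] := pick _ cP; have [y [Qy Zy]] := pick _ cQ.
have [K [Kc KT Kx Ky KZ]] :=
  disk_like_minus_countable _ _ _ _ _ dT cZ (PT _ _ Px) (QT _ _ Qy) Zx Zy.
have nZ p : K p -> ~ Z p.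
  by move=> Kp Zp; suff : (K `&` Z) p by rewrite KZ.
have cover' n p : T p -> [\/ Q n p, P n p | T (e p)].
  by move=> /(cover n)[]; [constructor 2|constructor 1|constructor 3].
have PQZ' : eventually_in Q `&` eventually_in P `<=` Z by rewrite setIC.
have [U oU EU] := eventually_open _ _ Qcl QT cover PQZ _ KT KZ.
have [U' oU' EU'] := eventually_open _ _ Pcl PT cover' PQZ' _ KT KZ.
have : K `&` eventually_in P = K.
  apply: Kc; first by exists x; split => //; exists 0%N.
    by exists U.
  exists (~` U'); first exact: open_closedC.
  apply/seteqP; split => p [Kp Hp]; split => //.
    move=> U'p; apply: (nZ _ Kp); apply: PQZ; split => //.
    suff : (K `&` U') p by rewrite -EU' => -[].
    by [].
  have [//|Qp] := eventually_cover _ _ cover _ (KT _ Kp) (nZ _ Kp).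
  suff : (K `&` eventually_in Q) p by rewrite EU' => -[].
  by [].
move=> E; have : (K `&` eventually_in P) y by rewrite E.
by move=> [_ Py]; apply: Zy; apply: PQZ; split => //; exists 0%N.
Qed.

End Cut.

Lemma disk_like_not_union (R : realType) (T P Q : set (R * R)) :
  disk_like T -> T = P `|` Q -> closed P -> closed Q ->
  countable (P `&` Q) -> ~ countable P -> ~ countable Q -> False.
Proof.
move=> dT TPQ cP cQ cPQ uP uQ.
have pick A : ~ countable A -> exists x, A x /\ ~ (P `&` Q) x.
  move=> cA; apply: contrapT => h; apply: cA; apply: sub_countable cPQ.
  apply: subset_card_le => x Ax; apply: contrapT => Zx; apply: h; by exists x.
have [x [Px Zx]] := pick _ uP; have [y [Qy Zy]] := pick _ uQ.
have PT : P `<=` T by rewrite TPQ; left.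
have QT : Q `<=` T by rewrite TPQ; right.
have [K [Kc KT Kx Ky KZ]] :=
  disk_like_minus_countable _ _ _ _ _ dT cPQ (PT _ Px) (QT _ Qy) Zx Zy.
have E : K `&` P = K.
  apply: Kc; [by exists x| |by exists P].
  exists (~` Q); first exact: closed_openC.
  apply/seteqP; split => p [Kp Hp]; split => //.
    by move=> Qp; suff : (K `&` (P `&` Q)) p by rewrite KZ.
  by have := KT _ Kp; rewrite TPQ => -[].
by apply: Zy; split => //; have : (K `&` P) y; [rewrite E|case].
Qed.

(** * Digit expansions *)

(** Digit [i] acts by [q |-> s q + (k, 0)], with [s] its sign and [k] its shift; the index [b - 1],
    and any beyond it, stands for the rotation [c]. *)
Definition digit_sign (b i : nat) : int := if (i < b.-1)%N then 1 else -1.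
Definition digit_shift (b i : nat) : int := if (i < b.-1)%N then i%:Z else 0.

(* [digit_i^-1 \o g], where digit [i < b - 1] is [a^i] and digit [b - 1] is [c]. *)
Definition expand {R : realType} (A : int) (b i : nat) (p : R * R) : R * R :=
  ((digit_sign b i)%:~R * ((tile_g A b%:Z p).1 - (digit_shift b i)%:~R),
   (digit_sign b i)%:~R * (tile_g A b%:Z p).2).

Definition contract {R : realType} (A : int) (b i : nat) (q : R * R) : R * R :=
  let u := (digit_sign b i)%:~R * q.1 + (digit_shift b i)%:~R in
  let v := (digit_sign b i)%:~R * q.2 in
  let y := ((b%:R - 1) / 2 - u) / b%:R in
  (v + A%:~R * y, y).

Lemma digit_signP (b i : nat) : digit_sign b i = 1 \/ digit_sign b i = -1.
Proof. by rewrite /digit_sign; case: ifP; [left|right]. Qed.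

Section Expand.
Context (R : realType) (A : int) (b : nat).
Context (b0 : (0 < b)%N).
Local Notation E := (@expand R A b).

Let bR0 : b%:R != 0 :> R. Proof. by rewrite pnatr_eq0 -lt0n. Qed.

Let signK (i : nat) (x : R) :
  (digit_sign b i)%:~R * ((digit_sign b i)%:~R * x) = x.
Proof. by case: (digit_signP b i) => ->; rewrite ?mulr1z ?mulrN1z !(mulNr, mul1r) ?opprK. Qed.

Lemma expandK i : cancel (contract A b i) (E i).
Proof.
case=> u v; rewrite /expand /contract /tile_g /=.
set s := (digit_sign b i)%:~R; set k := (digit_shift b i)%:~R.
have -> : - b%:~R * (((b%:R - 1) / 2 - (s * u + k)) / b%:R) + (b%:~R - 1) / 2 - k = s * u.
  by field.
by rewrite addrK !signK.
Qed.

Lemma contractK i : cancel (E i) (contract A b i).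
Proof.
case=> u v; rewrite /expand /contract /tile_g /= !signK subrK.
have -> : ((b%:R - 1) / 2 - (- b%:~R * v + (b%:~R - 1) / 2)) / b%:R = v :> R by field.
by rewrite subrK.
Qed.

Lemma expand_inj i : injective (E i).
Proof. exact: can_inj (contractK i). Qed.

Lemma continuous_expand i : continuous (E i).
Proof.
have cF (c1 c2 c3 : R) : continuous (fun p : R * R => c1 * p.1 + c2 * p.2 + c3).
  move=> p; apply: cvgD; last exact: cvg_cst.
  apply: cvgD; apply: cvgM; (try exact: cvg_cst); [exact: cvg_fst | exact: cvg_snd].
move=> p; set s : R := (digit_sign b i)%:~R; set k : R := (digit_shift b i)%:~R.
have -> : E i = fun p => (0 * p.1 + (- s * b%:R) * p.2 + s * ((b%:R - 1) / 2 - k),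
                       s * p.1 + (- s * A%:~R) * p.2 + 0).
  by apply/funext => -[u v]; rewrite /expand /tile_g /= -/s -/k; congr pair; ring.
exact: (cvg_pair (cF _ _ _ p) (cF _ _ _ p)).
Qed.

Lemma iter_tile_a (n : nat) (p : R * R) : iter n tile_a p = (p.1 + n%:R, p.2).
Proof.
elim: n => [|n IH] /=; first by rewrite addr0 -surjective_pairing.
by rewrite IH /tile_a /= -addrA natr1.
Qed.

Lemma tile_g_expand i p : tile_g A b%:Z p =
  ((digit_sign b i)%:~R * (E i p).1 + (digit_shift b i)%:~R,
   (digit_sign b i)%:~R * (E i p).2).
Proof. by rewrite /expand /= !signK subrK. Qed.

Lemma tile_g_inj : injective (@tile_g R A b%:Z).
Proof.
move=> p q pq; apply: (expand_inj 0).
by rewrite /expand pq.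
Qed.

Lemma tileP (T : set (R * R)) p : (1 < b)%N -> tile_equation A b%:Z T ->
  T p <-> exists2 i, (i < b)%N & T (E i p).
Proof.
move=> b1 TE; split => [Tp|[i ib Ti]].
  have : (tile_g A b%:Z @` T) (tile_g A b%:Z p) by exists p.
  rewrite TE => -[[k /= kb [q Tq qp]]|[q Tq qp]].
    have kb' : (k < b.-1)%N by move: kb; lia.
    exists k; first lia.
    rewrite /expand -qp iter_tile_a /digit_sign /digit_shift kb' /=.
    by rewrite mulr1z !mul1r addrK -surjective_pairing.
  exists b.-1; first lia.
  rewrite /expand -qp /tile_c /digit_sign /digit_shift ltnn /=.
  by rewrite mulrN1z subr0 !mulN1r !opprK -surjective_pairing.
have : (tile_g A b%:Z @` T) (tile_g A b%:Z p); last by move=> [q Tq /tile_g_inj <-].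
rewrite TE (tile_g_expand i); case: (ltnP i b.-1) => ib'.
  left; exists i; first by rewrite /=; lia.
  exists (E i p) => //.
  by rewrite iter_tile_a /digit_sign /digit_shift ib' mulr1z !mul1r.
right; exists (E i p) => //.
by rewrite /tile_c /digit_sign /digit_shift ltnNge ib' /= mulrN1z !mulN1r addr0.
Qed.

End Expand.

(* The state [(s, x, y)] encodes the group element [q |-> s q + (x, y)]. *)
Definition related {R : realType} (st : int * int * int) (p q : R * R) : Prop :=
  p.1 = st.1.1%:~R * q.1 + st.1.2%:~R /\ p.2 = st.1.1%:~R * q.2 + st.2%:~R.

(** If [st] encodes [h], this encodes [E_i h E_j^-1]. The vector [(u, x - A y)] is the translation
    part of [g h g^-1]: the linear part of [g] sends [(x, y)] to [(- b y, x - A y)], and for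
    [s = -1] the translation of [g] counts twice, whence [b - 1]. *)
Definition child (A : int) (b : nat) (st : int * int * int) (i j : nat)
  : int * int * int :=
  let: (s, x, y) := st in
  let u := - (b%:Z * y) + (if s == 1 then 0 else b%:Z - 1) in
  (digit_sign b i * s * digit_sign b j,
   digit_sign b i * (u + s * digit_shift b j - digit_shift b i),
   digit_sign b i * (x - A * y)).

Definition signed (st : int * int * int) := (st.1.1 == 1) || (st.1.1 == -1).

Lemma signed_child (A : int) (b i j : nat) (st : int * int * int) :
  signed st -> signed (child A b st i j).
Proof.
case: st => [[s x] y]; rewrite /signed /=.
by case: (digit_signP b i) => ->; case: (digit_signP b j) => -> /orP[]/eqP ->.
Qed.

Lemma related_refl (R : realType) (p : R * R) : related (1, 0, 0) p p.
Proof. by rewrite /related /= mulr1z mulr0z !addr0 !mul1r. Qed.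

Lemma related_child (R : realType) (A : int) (b i j : nat) st (p q : R * R) :
  signed st -> related st p q ->
  related (child A b st i j) (expand A b i p) (expand A b j q).
Proof.
case: st p q => [[s x] y] [p1 p2] [q1 q2]; rewrite /signed /related /expand /tile_g /=.
move=> ss [-> ->].
have dj : (digit_sign b j)%:~R * (digit_sign b j)%:~R = 1 :> R.
  by case: (digit_signP b j) => ->; rewrite ?mulr1z ?mulrN1z ?mulrNN mul1r.
rewrite !(rmorphM, rmorphD, rmorphN, rmorphB) /=.
set e := (digit_sign b i)%:~R; set f := (digit_sign b j)%:~R in dj *.
set k := (digit_shift b i)%:~R; set l := (digit_shift b j)%:~R.
have dj' z : e * s%:~R * f * (f * z) = e * (s%:~R * z).
  by rewrite -!mulrA (mulrA f) dj mul1r.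
rewrite !dj'.
by case/orP: ss => /eqP -> /=; split; rewrite ?mulr1z ?mulrN1z ?mulr0z; field.
Qed.

(** * The automaton of relations *)

(* [forallL] short-circuits under call-by-value evaluation, unlike [all]. *)
Fixpoint forallL (p : nat -> bool) (s : seq nat) : bool :=
  if s is x :: s' then if p x then forallL p s' else false else true.

Lemma forallLE p s : forallL p s = all p s.
Proof. by elim: s => //= x s ->; case: (p x). Qed.

Definition forall_digits (b : nat) (p : nat -> nat -> bool) : bool :=
  forallL (fun i => forallL (p i) (iota 0 b)) (iota 0 b).

Lemma forall_digitsP b p i j :
  forall_digits b p -> (i < b)%N -> (j < b)%N -> p i j.
Proof.
rewrite /forall_digits forallLE => /allP h ib jb.
have := h i; rewrite forallLE mem_iota => /(_ ib)/allP /(_ j).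
by rewrite mem_iota => /(_ jb).
Qed.

Section Search.
Context (far : int -> bool) (A : int) (b : nat).

(** Every child has height [x - A y] up to sign, whatever the digits, so the second test looks one
    step ahead at no cost. *)
Definition out_of_range (st : int * int * int) : bool :=
  far st.2 || far (st.1.2 - A * st.2).

Fixpoint dead (n : nat) (st : int * int * int) : bool :=
  if out_of_range st then true else
  if n is n'.+1 then forall_digits b (fun i j => dead n' (child A b st i j))
  else false.

(** [find] returns [b], which is no digit, when the state has no loop. *)
Definition loop_digit (st : int * int * int) : nat :=
  find (fun j => has (fun i => child A b st i j == st) (iota 0 b)) (iota 0 b).

(* A state all of whose successors are thin, except for loops through a single
   digit of [q], has only countably many [q]: either the loop is followed forever,
   which determines [q], or a thin state is reached after finitely many steps. *)
Fixpoint thin (d n : nat) (st : int * int * int) : bool :=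
  if dead d st then true else
  if n is n'.+1 then
    let j0 := loop_digit st in
    forall_digits b (fun i j => let c := child A b st i j in
      if c == st then j == j0 else thin d n' c)
  else false.

(* The two groups of digits lying on either side of the digit [k]. *)
Definition on_side (k : nat) (l : bool) (i : nat) : bool :=
  if l then (i < k)%N || (i == b.-1) else (k < i < b.-1)%N.

Context (alt : bool) (k : nat).

(* Here [q] lies on the side [l] of [k], possibly only after expanding the digit
   [k] several times; [alt] records that the sides are exchanged at each step. *)
Fixpoint separated (d n : nat) (l : bool) (st : int * int * int) : bool :=
  if thin d n st then true else
  if n is n'.+1 then
    forall_digits b (fun i j => let c := child A b st i j in
      if j == k then separated d n' (l (+) alt) c
      else if on_side k l j then thin d n' c else true)
  else false.

(** A point common to both sides is related to itself by the identity, hence the initial state; [i]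
    begins its expansion on the side [l], and [j] an expansion leading to the opposite side. *)
Definition sides_separated (d n : nat) (l : bool) : bool :=
  forall_digits b (fun i j => let c := child A b (1, 0, 0) i j in
    if on_side k l i then
      if j == k then separated d n (~~ l (+) alt) c
      else if on_side k (~~ l) j then thin d n c else true
    else true).

End Search.

(** * Countable overlaps read off the automaton *)

Section Tile.
Context (R : realType) (A : int) (b : nat) (b0 : (0 < b)%N) (T : set (R * R)).
Local Notation E := (@expand R A b).
Context (TP : forall p, T p <-> exists2 i, (i < b)%N & T (E i p)).
Context (far : int -> bool).
Context (far_opp : forall y, far (- y) = far y).
Context (farP : forall st p q, signed st -> T p -> T q -> related st p q ->
  ~~ far st.2).
Context (forever : forall j p q, (j < b)%N -> (forall n, T (iter n (E j) p)) ->
  (forall n, T (iter n (E j) q)) -> p = q).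

Definition partners (st : int * int * int) : set (R * R) :=
  [set q | T q /\ exists p, T p /\ related st p q].

Lemma expand_in j p : (j < b)%N -> T (E j p) -> T p.
Proof. by move=> jb Tp; apply/TP; exists j. Qed.

Lemma related_step st p q : signed st -> T p -> T q -> related st p q ->
  exists i j, [/\ (i < b)%N, (j < b)%N, T (E i p), T (E j q) &
    related (child A b st i j) (E i p) (E j q)].
Proof.
move=> sst /TP[i ib Tp] /TP[j jb Tq] rpq; exists i, j; split => //.
exact: related_child.
Qed.

Lemma out_of_range_partners st :
  signed st -> out_of_range far A st -> partners st = set0.
Proof.
move=> sst ho; apply/seteqP; split => // q [Tq [p [Tp rpq]]].
have [i [j [ib jb Ti Tj rij]]] := related_step _ _ _ sst Tp Tq rpq.
case/orP: ho => ho; first by have := farP _ _ _ sst Tp Tq rpq; rewrite ho.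
have := farP _ _ _ (signed_child A b i j _ sst) Ti Tj rij.
move: ho; case: st {sst rpq rij} => [[s x] y] /= ho.
by case: (digit_signP b i) => ->; rewrite ?mul1r ?mulN1r ?far_opp ho.
Qed.

Lemma dead_partners n st : signed st -> dead far A b n st -> partners st = set0.
Proof.
elim: n st => [|n IH] st sst /=; case: ifP => [ho _|_ hd] //;
  try exact: out_of_range_partners.
apply/seteqP; split => // q [Tq [p [Tp rpq]]].
have [i [j [ib jb Ti Tj rij]]] := related_step _ _ _ sst Tp Tq rpq.
have := IH _ (signed_child A b i j _ sst) (forall_digitsP _ _ _ _ hd ib jb).
move=> h; suff : partners (child A b st i j) (E j q) by rewrite h.
by split => //; exists (E i p).
Qed.

Lemma countable_forever j :
  (j < b)%N -> countable [set p | forall n, T (iter n (E j) p)].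
Proof.
move=> jb; apply/countable_injP; exists (fun=> 0%N) => p q.
by rewrite !inE => hp hq _; exact: forever jb hp hq.
Qed.

Lemma countable_iter_preimage j n (C : set (R * R)) :
  countable C -> countable (iter n (E j) @^-1` C).
Proof.
move=> cC; apply: countable_preimage => //.
elim: n => [|n IH] p q //= /(expand_inj R A b b0); exact: IH.
Qed.

(** A point of [W] enters [C] after finitely many expansions by [j], or follows [j] forever. *)
Lemma countable_selfsim j (C W : set (R * R)) : (j < b)%N -> W `<=` T ->
  countable C -> W `<=` C `|` (E j @^-1` W) -> countable W.
Proof.
move=> jb WT cC WC.
apply: (sub_countable _ (B := [set p | forall n, T (iter n (E j) p)] `|`
    \bigcup_n (iter n (E j) @^-1` C))); last first.
  apply: countable_setU; first exact: countable_forever.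
  apply: bigcup_countable => // n _; exact: countable_iter_preimage.
apply: subset_card_le => p Wp.
have [[n Cn]|h] := pselect (exists n, C (iter n (E j) p)); first by right; exists n.
left; move=> n; apply: WT; elim: n => [//|n IH].
by case: (WC _ IH) => // Cn; exfalso; apply: h; exists n.
Qed.

Lemma countable_digits (F : nat -> nat -> set (R * R)) :
  (forall i j, (i < b)%N -> (j < b)%N -> countable (F i j)) ->
  countable (\bigcup_(i in `I_b) \bigcup_(j in `I_b) E j @^-1` F i j).
Proof.
move=> cF; apply: bigcup_countable => // i ib.
apply: bigcup_countable => // j jb.
apply: countable_preimage; [exact: expand_inj | exact: cF].
Qed.

(** A pair of digits leads either to a child that is thin with less fuel, or back to [st] through
    the single digit [j0]; [countable_selfsim] absorbs the loop. *)
Lemma thin_partners d n st : signed st -> thin far A b d n st ->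
  countable (partners st).
Proof.
elim: n st => [|n IH] st sst /=; case: ifP => [hd _|_ ht] //;
  try by rewrite (dead_partners _ _ sst hd); exact: countable0.
pose j0 := loop_digit A b st.
pose F i j := if child A b st i j == st then set0 else partners (child A b st i j).
have cF : countable (\bigcup_(i in `I_b) \bigcup_(j in `I_b) E j @^-1` F i j).
  apply: countable_digits => i j ib jb; rewrite /F; have := forall_digitsP _ _ _ _ ht ib jb.
  case: ifP => // _ hc; apply: (IH _ _ hc); exact: signed_child.
have step q : partners st q ->
    (\bigcup_(i in `I_b) \bigcup_(j in `I_b) E j @^-1` F i j) q \/
    (j0 < b)%N /\ partners st (E j0 q).
  move=> [Tq [p [Tp rpq]]].
  have [i [j [ib jb Ti Tj rij]]] := related_step _ _ _ sst Tp Tq rpq.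
  have := forall_digitsP _ _ _ _ ht ib jb; case: ifP => [/eqP e /eqP jj|e _].
    by right; rewrite -[j0]jj; split => //; rewrite -{1}e; split => //; exists (E i p).
  by left; exists i => //; exists j => //; rewrite /F /= e; split => //; exists (E i p).
have [jb|jb] := ltnP j0 b.
  apply: (countable_selfsim j0) cF _ => // [q [] //|q /step[]]; [by left|by case; right].
apply: sub_countable cF; apply: subset_card_le => q /step[//|[]].
by rewrite ltnNge jb.
Qed.

Context (alt : bool) (k : nat).
Context (k0 : (k < b.-1)%N).

Let kb : (k < b)%N. Proof. by move: k0; lia. Qed.

Definition side (l : bool) : set (R * R) :=
  [set p | exists2 i, (i < b)%N && on_side b k l i & T (E i p)].

Definition side_seq (l : bool) (n : nat) : set (R * R) := side (l (+) (alt && odd n)).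

Local Notation ev l := (eventually_in R (E k) (side_seq l)).

Lemma ev_step l p : ev l p -> side l p \/ ev (l (+) alt) (E k p).
Proof.
move=> [[|n]]; rewrite /side_seq; first by rewrite andbF addbF; left.
move=> h; right; exists n; move: h; rewrite -iterSr /side_seq; congr side.
by rewrite /=; case: alt; case: l; case: odd.
Qed.

Lemma side_in l p : side l p -> T p.
Proof. by move=> [i /andP[ib _] Ti]; exact: expand_in ib Ti. Qed.

Lemma ev_in l p : ev l p -> T p.
Proof.
move=> [n /side_in]; elim: n => //= n IH Tn; apply: IH; exact: expand_in kb Tn.
Qed.

Lemma separated_partners d n l st : signed st -> separated far A b alt k d n l st ->
  countable (partners st `&` ev l).
Proof.
elim: n l st => [|n IH] l st sst.
  move=> /=; case: ifP => // ht _; apply: (sub_countable _ (B := partners st)).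
    by apply: subset_card_le => p [].
  exact: (thin_partners d 0).
rewrite [separated _ _ _ _ _ _ _ _ _]/=; case: ifP => [ht _|_ hs].
  apply: (sub_countable _ (B := partners st)); first by apply: subset_card_le => p [].
  exact: (thin_partners d n.+1).
pose F i j := let c := child A b st i j in
  if j == k then partners c `&` ev (l (+) alt)
  else if on_side b k l j then partners c else set0.
apply: (sub_countable _ (B :=
  \bigcup_(i in `I_b) \bigcup_(j in `I_b) E j @^-1` F i j)); last first.
  apply: countable_digits => i j ib jb; rewrite /F; have := forall_digitsP _ _ _ _ hs ib jb.
  have sc := signed_child A b i j _ sst.
  case: ifP => _; first exact: IH.
  by case: ifP => // _; exact: thin_partners.
apply: subset_card_le => q [[Tq [p [Tp rpq]]] /ev_step qe].
have /TP[i ib Ti] := Tp; exists i => //.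
case: qe => [[j /andP[jb jl] Tj]|ek].
  exists j => //; rewrite /F /=.
  have jk : j == k = false.
    by apply/negbTE/eqP => e; move: jl; rewrite e /on_side; case: (l); move: k0; lia.
  rewrite jk jl; split => //; exists (E i p); split => //; exact: related_child.
exists k => //; rewrite /F /= eqxx; split => //; split; first exact: ev_in ek.
by exists (E i p); split => //; exact: related_child.
Qed.

Lemma sides_separatedP d n l : sides_separated far A b alt k d n l ->
  countable (side l `&` ev (~~ l)).
Proof.
move=> hs.
have s0 : signed (1, 0, 0) by [].
pose F i j := let c := child A b (1, 0, 0) i j in
  if on_side b k l i then
    if j == k then partners c `&` ev (~~ l (+) alt)
    else if on_side b k (~~ l) j then partners c else set0
  else set0.
apply: (sub_countable _ (B :=
  \bigcup_(i in `I_b) \bigcup_(j in `I_b) E j @^-1` F i j)); last first.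
  apply: countable_digits => i j ib jb; rewrite /F; have := forall_digitsP _ _ _ _ hs ib jb.
  have sc := signed_child A b i j _ s0.
  case: ifP => // _; case: ifP => _; first exact: separated_partners.
  by case: ifP => // _; exact: thin_partners.
apply: subset_card_le => q [[i /andP[ib il] Ti] /ev_step qe]; exists i => //.
have rel j := related_child R A b i j _ _ _ s0 (related_refl R q).
case: qe => [[j /andP[jb jl] Tj]|ek].
  exists j => //; rewrite /F /= il.
  have jk : j == k = false.
    by apply/negbTE/eqP => e; move: jl; rewrite e /on_side; case: (l) => /=; move: k0; lia.
  by rewrite jk jl; split => //; exists (E i q); split => //; exact: rel.
exists k => //; rewrite /F /= il eqxx; split => //; split; first exact: ev_in ek.
by exists (E i q); split => //; exact: rel.
Qed.

Context (Tcl : closed T).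

Lemma closed_expand_preimage i : closed (E i @^-1` T).
Proof. by apply: preimage_closed => // p _; exact: continuous_expand. Qed.

Lemma closed_digits (P : pred nat) :
  closed [set p | exists2 i, (i < b)%N && P i & T (E i p)].
Proof.
have -> : [set p | exists2 i, (i < b)%N && P i & T (E i p)] =
    \bigcup_(i in `I_b) (if P i then E i @^-1` T else set0).
  apply/seteqP; split => p.
    by move=> [i /andP[ib Pi] Ti]; exists i => //; rewrite Pi.
  by move=> [i ib]; case: ifP => // Pi Ti; exists i => //; rewrite Pi andbT.
rewrite bigcup_mkord; elim/big_ind: _ => [|B C|i _]; [exact: closed0|exact: closedU|].
by case: ifP => _; [exact: closed_expand_preimage|exact: closed0].
Qed.

Context (dT : disk_like T).

Lemma uncountable_expand i (W : set (R * R)) : E i @^-1` T `<=` W -> ~ countable W.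
Proof.
move=> iW cW; apply: (disk_like_uncountable R T dT).
have -> : T = contract A b i @^-1` (E i @^-1` T).
  by apply/seteqP; split => p /=; rewrite expandK.
apply: countable_preimage; first exact: can_inj (expandK R A b b0 i).
by apply: sub_countable cW; exact: subset_card_le.
Qed.

Lemma not_disk_of_separated : (k.+1 < b.-1)%N ->
  (forall l, countable (side l `&` ev (~~ l))) -> False.
Proof.
move=> kb1 cut.
pose X := [set p | forall n, T (iter n (E k) p)].
(* Besides the points following [k] forever, [Z] takes those which at some time are on one side and
   eventually on the other. *)
pose Z := X `|` \bigcup_n (iter n (E k) @^-1`
  ((side true `&` ev false) `|` (side false `&` ev true))).
have cZ : countable Z.
  apply: countable_setU; first exact: countable_forever kb.
  apply: bigcup_countable => // n _; apply: countable_iter_preimage.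
  by apply: countable_setU; [exact: (cut true) | exact: (cut false)].
apply: (disk_like_cut R T Z (E k) _ _ _ _ (side_seq true) (side_seq false)) => //.
- exact: continuous_expand.
- by move=> p Tp; exact: expand_in kb Tp.
- by move=> p hp; left.
- by move=> n; exact: closed_digits.
- by move=> n; exact: closed_digits.
- by move=> n p /side_in.
- by move=> n p /side_in.
- move=> n p /TP[i ib Ti].
  have [e|ik] := eqVneq i k; first by constructor 3; rewrite -e.
  have : on_side b k true i || on_side b k false i.
    by rewrite /on_side; move: ib ik k0; lia.
  have sideI l : on_side b k l i -> side l p by move=> h; exists i; rewrite ?ib.
  move=> /orP[/sideI h|/sideI h]; rewrite /side_seq; case: (alt && odd n);
    by [constructor 1 | constructor 2].
(* When both sides are reached, the later event is seen from the time of the earlier one, whose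
   parity tells which name each side has. *)
- have shift l n m p : side_seq (~~ l) (n + m) (iter (n + m) (E k) p) ->
      ev (~~ l (+) (alt && odd n)) (iter n (E k) p).
    move=> h; exists m; move: h; rewrite addnC iterD /side_seq; congr side.
    by rewrite oddD; case: alt; case: l; case: odd; case: odd.
  move=> p [[n Pn] [m Qm]].
  have [/subnKC nm|/ltnW/subnKC nm] := leqP n m.
    right; exists n => //=; move: Qm; rewrite -nm => /(shift true).
    move: Pn; rewrite /side_seq; case: (alt && odd n) => /= Pn h; [right|left]; by split.
  right; exists m => //=; move: Pn; rewrite -nm => /(shift false).
  move: Qm; rewrite /side_seq; case: (alt && odd m) => /= Pn h; [left|right]; by split.
- apply: (uncountable_expand b.-1) => p Tp; rewrite /side_seq andbF addbF.
  by exists b.-1 => //; rewrite /on_side eqxx orbT andbT; move: b0; lia.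
- apply: (uncountable_expand k.+1) => p Tp; rewrite /side_seq andbF addbF.
  by exists k.+1 => //; rewrite /on_side; move: kb1; lia.
Qed.

(** Here a single subtile is cut off from the union of the others: thin relations between them make
    the overlap countable. *)
Lemma not_disk_of_thin d n : (1 < b)%N ->
  forallL (fun i => if i == k then true else thin far A b d n (child A b (1, 0, 0) i k))
    (iota 0 b) -> False.
Proof.
move=> b1; rewrite forallLE => /allP hthin.
pose Q := [set p | exists2 i, (i < b)%N && (i != k) & T (E i p)].
apply: (disk_like_not_union R T (E k @^-1` T) Q dT).
- apply/seteqP; split => p.
    move=> /TP[i ib Ti]; have [e|ik] := eqVneq i k; first by left; rewrite -e.
    by right; exists i => //; rewrite ib.
  by move=> [|[i /andP[ib _]]]; exact: expand_in.
- exact: closed_expand_preimage.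
- exact: closed_digits.
- pose F i := if i == k then set0 else partners (child A b (1, 0, 0) i k).
  apply: (sub_countable _ (B := \bigcup_(i in `I_b) E k @^-1` F i)); last first.
    apply: bigcup_countable => // i ib; apply: countable_preimage; first exact: expand_inj.
    have /= := hthin i; rewrite /F mem_iota => /(_ ib); case: ifP => // _.
    by apply: (thin_partners d n); apply: (signed_child A b i k (1, 0, 0)).
  apply: subset_card_le => p [Tk [i /andP[ib /negbTE ik] Ti]]; exists i => //.
  rewrite /F /= ik; split => //; exists (E i p); split => //.
  exact: (related_child R A b i k (1, 0, 0) _ _ _ (related_refl R p)).
- exact: (uncountable_expand k).
- have : exists2 i, (i < b)%N & i != k.
    by have [->|] := eqVneq k 0%N; [exists 1%N | move=> h; exists 0%N => //; rewrite eq_sym].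
  move=> [i ib ik]; apply: (uncountable_expand i) => p Tp; exists i => //.
  by rewrite ib.
Qed.

End Tile.

(** * The height of the tile *)

(** For the supremum [M] of [f] on [S], the hypothesis gives [M <= th * M + c]. *)
Lemma contraction_bound (R : realType) (X : Type) (S : set X) (f : X -> R) (th c K : R) :
  th < 1 -> (forall s, S s -> f s <= K) ->
  (forall K', (forall s, S s -> f s <= K') -> forall s, S s -> f s <= th * K' + c) ->
  forall s, S s -> f s <= c / (1 - th).
Proof.
move=> th1 SK contr s Ss.
have fS : has_sup (f @` S).
  by split; [exists (f s), s | exists K => _ [t St <-]; exact: SK].
have le_sup t : S t -> f t <= sup (f @` S).
  by move=> St; apply: sup_upper_bound => //; exists t.
apply: le_trans (le_sup _ Ss) _.
rewrite ler_pdivlMr ?subr_gt0 // mulrBr mulr1 lerBlDr addrC [X in X + _]mulrC.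
apply: ge_sup => [|_ [t St <-]]; first by case: fS.
exact: contr.
Qed.

(** A step is the linear part of [g] with a horizontal displacement. This covers points of the tile,
    displaced by their digits, and differences of points with equal digits, where [c = 0]. *)
Definition shift_invariant {R : realType} (A : int) (b : nat) (c : R)
    (S : set (R * R)) : Prop :=
  forall r, S r -> exists2 d, `|d| <= c &
    S (- (b%:R * r.2) - d, r.1 - A%:~R * r.2).

Definition height_bound (R : realType) (A : int) (b : nat) (C : R) : Prop :=
  forall (S : set (R * R)) (c K : R),
    (forall r, S r -> `|r.1| <= K /\ `|r.2| <= K) -> shift_invariant A b c S ->
    forall r, S r -> `|r.2| <= C * c.

(* With [A = sg * a], the matrix of [g] has eigenvalues [- sg * al] and
   [- sg * be], where [al * be = b], [al + be = a] and [al, be > 1]. *)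
Lemma height_bound_real (R : realType) (sg : bool) (a b : nat) :
  (3 <= a)%N -> (a <= b)%N -> (4 * b <= a ^ 2)%N ->
  height_bound R ((-1) ^+ sg * a%:Z) b (b%:R - a%:R + 1)^-1.
Proof.
move=> a3 ab ab4 S c K SK Sinv r Sr.
pose aR : R := a%:R; pose bR : R := b%:R.
have a3R : 3 <= aR by rewrite ler_nat.
have abR : aR <= bR by rewrite ler_nat.
have ab4R : 4 * bR <= aR ^+ 2 by rewrite -natrX -natrM ler_nat.
pose D := Num.sqrt (aR ^+ 2 - 4 * bR).
have D0 : 0 <= D by exact: sqrtr_ge0.
have D2 : D ^+ 2 = aR ^+ 2 - 4 * bR by rewrite sqr_sqrtr // subr_ge0.
pose al := (aR - D) / 2; pose be := (aR + D) / 2.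
have albe : al * be = bR by rewrite /al /be; nra.
have aleb : al + be = aR by rewrite /al /be; lra.
have lt_al : 1 < al.
  have h : (al - 1) * (be - 1) = bR - aR + 1 by rewrite -albe -aleb; ring.
  have hbe : 0 < be - 1 by rewrite /be; lra.
  rewrite -subr_gt0 -(pmulr_lgt0 _ hbe) h; lra.
have lt_be : 1 < be by apply: lt_le_trans lt_al _; rewrite /al /be; lra.
pose s : R := (-1) ^+ sg.
have s2 : s * s = 1 by rewrite /s -expr2 sqrr_sign.
have AE : ((-1) ^+ sg * a%:Z)%:~R = s * aR :> R.
  by rewrite rmorphM rmorphXn rmorphN1.
have ns (x : R) : `|s * x| = `|x| by rewrite normrM normrX normrN1 expr1n mul1r.
have c0 : 0 <= c by have [d hd _] := Sinv _ Sr; exact: le_trans hd.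
(* The form [p.1 - s * al * p.2] is a left eigenvector of the linear part of [g], with eigenvalue
   [- s * al]. *)
pose f (p : R * R) := `|p.1 - s * al * p.2|.
have fS p : S p -> f p <= c / (al - 1).
  move=> Sp; have -> : c / (al - 1) = (c / al) / (1 - al^-1).
    by field; rewrite !gt_eqF ?subr_gt0 //; lra.
  apply: (contraction_bound _ _ S f _ _ (K + al * K)) => // [|q Sq|K' hK' q Sq].
  - by rewrite invf_lt1 //; lra.
  - have [h1 h2] := SK _ Sq.
    apply: le_trans (ler_normB _ _) _; rewrite lerD // -mulrA ns normrM.
    by rewrite gtr0_norm ?ler_pM2l //; lra.
  - have [d hd Sq'] := Sinv _ Sq; have := hK' _ Sq'.
    rewrite /f AE /= => h.
    have e : - (bR * q.2) - d - s * al * (q.1 - s * aR * q.2) =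
             - (s * (al * (q.1 - s * al * q.2)) + d).
      rewrite -albe -aleb; have -> : s * al * (q.1 - s * (al + be) * q.2) =
        s * al * q.1 - (s * s) * al * (al + be) * q.2 by ring.
      have -> : s * (al * (q.1 - s * al * q.2)) = s * al * q.1 - (s * s) * al ^+ 2 * q.2.
        by ring.
      by rewrite s2; ring.
    rewrite -/bR e normrN in h.
    have : al * `|q.1 - s * al * q.2| <= K' + c.
      rewrite -[X in X * `|_| ](@gtr0_norm _ al) -?normrM -?[`|al * _|]ns; last lra.
      rewrite -[X in `|X|](addrK d).
      by apply: le_trans (ler_normB _ _) _; exact: lerD.
    by move=> hh; rewrite [_^-1 * _]mulrC -mulrDl ler_pdivlMr; [rewrite mulrC | lra].
(* The next height is the eigenform minus [s * be * q.2], so going back one step contracts heights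
   by [be^-1]. The constants combine through [(al - 1) * (be - 1) = b - a + 1]. *)
have -> : (b%:R - a%:R + 1)^-1 * c = (c / (al - 1) / be) / (1 - be^-1).
  have q0 : al * be - (al + be) + 1 != 0.
    have -> : al * be - (al + be) + 1 = (al - 1) * (be - 1) by ring.
    by rewrite mulf_neq0 // gt_eqF // subr_gt0.
  by rewrite -/aR -/bR -albe -aleb; field; rewrite q0 !gt_eqF //; lra.
apply: (contraction_bound _ _ S (fun p => `|p.2|) _ _ K) => // [|q /SK[]//|K' hK' q Sq].
  by rewrite invf_lt1 //; lra.
have [d hd Sq'] := Sinv _ Sq; have := hK' _ Sq'; have := fS _ Sq.
rewrite /f AE /= -aleb => h1 h2.
have : be * `|q.2| <= K' + c / (al - 1).
  rewrite -[X in X * `|_| ](@gtr0_norm _ be) -?normrM -?[`|be * _|]ns; last lra.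
  have -> : s * (be * q.2) = (q.1 - s * al * q.2) - (q.1 - s * (al + be) * q.2) by ring.
  by apply: le_trans (ler_normB _ _) _; rewrite addrC; exact: lerD.
by move=> hh; rewrite [_^-1 * _]mulrC -mulrDl ler_pdivlMr; [rewrite mulrC | lra].
Qed.

Lemma sign_nat_cast (R : realType) (sg : bool) (a : nat) :
  ((-1) ^+ sg * a%:Z)%:~R = (if sg then - a%:R else a%:R) :> R.
Proof.
by rewrite rmorphM rmorphXn rmorphN1 mulr_sign; case: sg.
Qed.

(** The eigenvalues are not real, so the recurrence [b y_n = - (y_{n+2} + A y_{n+1} + d_n)] is
    unrolled. The heights at times 4 and 5 enter the first one with weights [1/9] in size, hence the
    ratio [2/9]; the displacements have total weight 1. *)
Lemma height_bound_33 (R : realType) (sg : bool) :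
  height_bound R ((-1) ^+ sg * 3%:Z) 3%N (9 / 7).
Proof.
move=> S c K SK Sinv r Sr.
have -> : 9 / 7 * c = c / (1 - 2 / 9) by field.
apply: (contraction_bound _ _ S (fun p => `|p.2|) _ _ K) => // [|q /SK[]//|K' hK' q0 Sq0].
  by lra.
have [d0 h0 Sq1] := Sinv _ Sq0; have [d1 h1 Sq2] := Sinv _ Sq1.
have [d2 h2 Sq3] := Sinv _ Sq2; have [d3 h3 Sq4] := Sinv _ Sq3.
have [d4 h4 Sq5] := Sinv _ Sq4.
move: (hK' _ Sq4) (hK' _ Sq5) h0 h1 h2 h3.
rewrite sign_nat_cast /= !ler_norml; clear Sinv Sq1 Sq2 Sq3 Sq4 Sq5.
case: sg => /andP[? ?] /andP[? ?] /andP[? ?] /andP[? ?] /andP[? ?] /andP[? ?];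
  by apply/andP; split; lra.
Qed.

(** Unrolling to times 2 and 3 gives weights [11/25] and [4/25], and [9/25] for the
    displacements. *)
Lemma height_bound_45 (R : realType) (sg : bool) :
  height_bound R ((-1) ^+ sg * 4%:Z) 5%N (9 / 10).
Proof.
move=> S c K SK Sinv r Sr.
have -> : 9 / 10 * c = (9 / 25 * c) / (1 - 3 / 5) by field.
apply: (contraction_bound _ _ S (fun p => `|p.2|) _ _ K) => // [|q /SK[]//|K' hK' q0 Sq0].
  by lra.
have [d0 h0 Sq1] := Sinv _ Sq0; have [d1 h1 Sq2] := Sinv _ Sq1.
have [d2 h2 Sq3] := Sinv _ Sq2.
move: (hK' _ Sq2) (hK' _ Sq3) h0 h1.
rewrite sign_nat_cast /= !ler_norml; clear Sinv Sq1 Sq2 Sq3.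
case: sg => /andP[? ?] /andP[? ?] /andP[? ?] /andP[? ?];
  by apply/andP; split; lra.
Qed.

(** The weights at times 2 and 3 are now [18/49] and [5/49], with [12/49] for the displacements. *)
Lemma height_bound_57 (R : realType) (sg : bool) :
  height_bound R ((-1) ^+ sg * 5%:Z) 7%N (6 / 13).
Proof.
move=> S c K SK Sinv r Sr.
have -> : 6 / 13 * c = (12 / 49 * c) / (1 - 23 / 49) by field.
apply: (contraction_bound _ _ S (fun p => `|p.2|) _ _ K) => // [|q /SK[]//|K' hK' q0 Sq0].
  by lra.
have [d0 h0 Sq1] := Sinv _ Sq0; have [d1 h1 Sq2] := Sinv _ Sq1.
have [d2 h2 Sq3] := Sinv _ Sq2.
move: (hK' _ Sq2) (hK' _ Sq3) h0 h1.
rewrite sign_nat_cast /= !ler_norml; clear Sinv Sq1 Sq2 Sq3.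
case: sg => /andP[? ?] /andP[? ?] /andP[? ?] /andP[? ?];
  by apply/andP; split; lra.
Qed.

(** * Heights of relations between points of the tile *)

Section TileBounds.
Context (R : realType) (A : int) (b : nat) (b1 : (1 < b)%N) (T : set (R * R)).
Local Notation E := (@expand R A b).
Context (TE : tile_equation A b%:Z T) (Tc : compact T).
Context (C : R) (HC : height_bound R A b C).

Let b0 : (0 < b)%N. Proof. exact: ltnW. Qed.

Lemma tile_bounded : exists K : R, forall p, T p -> `|p.1| <= K /\ `|p.2| <= K.
Proof.
have [K [_ hK]] := compact_bounded Tc.
exists (K + 1) => p Tp; have := hK (K + 1) _ p Tp.
by rewrite ltrDl ltr01 /Num.norm /= ge_max => /(_ isT)/andP.
Qed.

Lemma tile_height p : T p -> `|p.2| <= C * ((b%:R - 1) / 2).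
Proof.
(* Adding [- T] absorbs the sign of the digit [c]. The translation of [g] recentres the shifts, so
   displacements are at most [(b - 1) / 2]. *)
pose S := [set r : R * R | T r \/ T (- r.1, - r.2)].
have [K hK] := tile_bounded.
suff h r : S r -> `|r.2| <= C * ((b%:R - 1) / 2) by move=> Tp; apply: h; left.
apply: (HC S _ K) => [q [/hK//|/hK]|q] ; first by rewrite /= !normrN.
have step u : T u -> exists2 d : R, `|d| <= (b%:R - 1) / 2 &
    S (- (b%:R * u.2) - d, u.1 - A%:~R * u.2).
  move=> /(tileP R A b b0 T u b1 TE)[i ib Ti].
  have g := tile_g_expand R A b i u; rewrite /tile_g in g.
  exists ((digit_shift b i)%:~R - (b%:R - 1) / 2).
    have : (0 <= digit_shift b i <= b%:Z - 2)%R.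
      by rewrite /digit_shift; case: ifP; lia.
    rewrite -!(ler_int R) rmorphB /= => /andP[h1 h2].
    by rewrite ler_norml; apply/andP; split; lra.
  move: Ti g; case: (E i u) => w1 w2 /= Tw [g1 g2].
  have -> : - (b%:R * u.2) - ((digit_shift b i)%:~R - (b%:R - 1) / 2) =
      (digit_sign b i)%:~R * w1 by lra.
  rewrite g2; case: (digit_signP b i) => ->.
    by left; rewrite mulr1z !mul1r.
  by right; rewrite /= mulrN1z !mulN1r !opprK.
move=> [/step//|/step[d hd /= hS]]; exists (- d); first by rewrite normrN.
have -> : - (b%:R * q.2) - - d = - (- (b%:R * - q.2) - d) by ring.
have -> : q.1 - A%:~R * q.2 = - (- q.1 - A%:~R * - q.2) by ring.
by case: hS => hS; [right; rewrite /= !opprK | left].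
Qed.

Lemma related_height st p q : signed st -> T p -> T q -> related st p q ->
  `|st.2%:~R| <= C * (b%:R - 1).
Proof.
move=> sst Tp Tq [_ e]; have hp := tile_height _ Tp; have hq := tile_height _ Tq.
have -> : C * (b%:R - 1) = C * ((b%:R - 1) / 2) + C * ((b%:R - 1) / 2) by field.
have -> : st.2%:~R = p.2 - st.1.1%:~R * q.2 by rewrite e addrC addKr.
apply: le_trans (ler_normB _ _) (lerD hp _).
by case/orP: sst => /eqP ->; rewrite ?mulr1z ?mulrN1z ?mul1r ?mulN1r ?normrN.
Qed.

(** Differences of points with equal digits evolve linearly and stay bounded, so the height bound
    with [c = 0] makes their heights vanish. The next height then gives the abscissa. *)
Lemma tile_forever j p q : (j < b)%N -> (forall n, T (iter n (E j) p)) ->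
  (forall n, T (iter n (E j) q)) -> p = q.
Proof.
move=> jb hp hq; have [K hK] := tile_bounded.
pose D n : R * R := ((iter n (E j) p).1 - (iter n (E j) q).1,
                     (iter n (E j) p).2 - (iter n (E j) q).2).
pose S := [set r | exists n, r = D n \/ r = (- (D n).1, - (D n).2)].
have Sinv : shift_invariant A b 0 S.
  move=> r [n rE]; exists 0; first by rewrite normr0.
  exists n.+1; rewrite /D !iterS; set u := iter n _ p; set v := iter n _ q.
  rewrite /expand /tile_g /= subr0; move: rE; rewrite /D -/u -/v => rE.
  case: (digit_signP b j) => ->; case: rE => -> /=;
    rewrite ?mulr1z ?mulrN1z ?mul1r ?mulN1r; [left|right|right|left];
    by congr pair; ring.
have Sb r : S r -> `|r.1| <= K + K /\ `|r.2| <= K + K.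
  have h n : `|(D n).1| <= K + K /\ `|(D n).2| <= K + K.
    have [h1 h2] := hK _ (hp n); have [h3 h4] := hK _ (hq n).
    by split; apply: le_trans (ler_normB _ _) _; exact: lerD.
  by move=> [n rE]; move: (h n); case: rE => ->; case: (D n) => u v //=; rewrite !normrN.
have S0 r : S r -> r.2 = 0.
  by move=> Sr; apply/eqP; rewrite -normr_le0 -(mulr0 C); exact: HC Sb Sinv _ Sr.
have SD : S (D 0%N) by exists 0%N; left.
have y0 := S0 _ SD; have [d] := Sinv _ SD; rewrite normr_le0 => /eqP -> /S0 /=.
move: y0; rewrite /D /= => y0; rewrite y0 mulr0 subr0 => x0.
by rewrite (surjective_pairing p) (surjective_pairing q); congr pair; apply/eqP;
  rewrite -subr_eq0 ?x0 ?y0.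
Qed.

Context (far : int -> bool) (far_opp : forall y, far (- y) = far y).
Context (far_height : forall y : int, `|y%:~R| <= C * (b%:R - 1) -> ~~ far y).

Lemma farP st p q : signed st -> T p -> T q -> related st p q -> ~~ far st.2.
Proof. by move=> sst Tp Tq rpq; apply: far_height; exact: related_height rpq. Qed.

Lemma closed_tile : closed T.
Proof. by apply: compact_closed => //; exact: norm_hausdorff. Qed.

Theorem not_disk_like_separated (alt : bool) (k d n : nat) : (k.+1 < b.-1)%N ->
  sides_separated far A b alt k d n true ->
  sides_separated far A b alt k d n false -> ~ disk_like T.
Proof.
move=> kb h1 h2 dT; have kb' : (k < b.-1)%N by exact: ltnW.
have TP p := tileP R A b b0 T p b1 TE.
apply: (not_disk_of_separated R A b b0 T TP tile_forever alt k kb' closed_tile dT kb).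
case; apply: (sides_separatedP R A b b0 T TP far far_opp farP tile_forever alt k kb' d n);
  by [exact: h1 | exact: h2].
Qed.

Theorem not_disk_like_thin (k d n : nat) : (k < b.-1)%N ->
  forallL (fun i => if i == k then true else thin far A b d n (child A b (1, 0, 0) i k))
    (iota 0 b) -> ~ disk_like T.
Proof.
move=> kb h dT.
have TP p := tileP R A b b0 T p b1 TE.
exact: (not_disk_of_thin R A b b0 T TP far far_opp farP tile_forever k kb closed_tile dT d n b1 h).
Qed.

End TileBounds.

(** * Small parameters *)

Definition farther (U : nat) (y : int) : bool := (U < `|y|)%N.

Lemma farther_opp U y : farther U (- y) = farther U y.
Proof. by rewrite /farther abszN. Qed.

Lemma farther_height (R : realType) (U : nat) (c : R) (y : int) :
  c < U%:R + 1 -> `|y%:~R| <= c -> ~~ farther U y.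
Proof.
move=> cU yc; rewrite /farther -leqNgt -ltnS -(ltr_nat R) natr_absz intr_norm.
by apply: le_lt_trans yc _; rewrite -natr1.
Qed.

Lemma not_disk_like_33 (R : realType) (sg : bool) (T : set (R * R)) :
  compact T -> tile_equation ((-1) ^+ sg * 3%:Z) 3%:Z T -> ~ disk_like T.
Proof.
move=> Tc TE.
have hC : 9 / 7 * (3%:R - 1) < 2%:R + 1 :> R by lra.
have hfar y := farther_height R 2%N _ y hC.
case: sg TE => TE.
  (* Digit 0 is cut off for [A = -3], digit 1 for [A = 3]; then come the fuels for dead and thin
     states. *)
  apply: (not_disk_like_thin R _ 3%N isT T TE Tc _ (height_bound_33 R true) (farther 2%N)
    (farther_opp 2%N) hfar 0%N 3%N 6%N); by vm_compute.
apply: (not_disk_like_thin R _ 3%N isT T TE Tc _ (height_bound_33 R false) (farther 2%N)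
  (farther_opp 2%N) hfar 1%N 3%N 6%N); by vm_compute.
Qed.

Lemma not_disk_like_44 (R : realType) (sg : bool) (T : set (R * R)) :
  compact T -> tile_equation ((-1) ^+ sg * 4%:Z) 4%:Z T -> ~ disk_like T.
Proof.
move=> Tc TE.
have hC : (4%:R - 4%:R + 1)^-1 * (4%:R - 1) < 3%:R + 1 :> R.
  by rewrite subrr add0r invr1; lra.
have hfar y := farther_height R 3%N _ y hC.
have hb (s : bool) : height_bound R ((-1) ^+ s * 4%:Z) 4%N (4%:R - 4%:R + 1)^-1.
  exact: height_bound_real.
case: sg TE => TE.
  (* After [hfar] come [alt], which is false for negative [A] and true for positive [A], the digit
     [k] and the two fuels. *)
  apply: (not_disk_like_separated R _ 4%N isT T TE Tc _ (hb true) (farther 3%N)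
    (farther_opp 3%N) hfar false 1%N 1%N 6%N); by vm_compute.
apply: (not_disk_like_separated R _ 4%N isT T TE Tc _ (hb false) (farther 3%N)
  (farther_opp 3%N) hfar true 1%N 1%N 6%N); by vm_compute.
Qed.

Lemma not_disk_like_45 (R : realType) (sg : bool) (T : set (R * R)) :
  compact T -> tile_equation ((-1) ^+ sg * 4%:Z) 5%:Z T -> ~ disk_like T.
Proof.
move=> Tc TE.
have hC : 9 / 10 * (5%:R - 1) < 3%:R + 1 :> R by lra.
have hfar y := farther_height R 3%N _ y hC.
case: sg TE => TE.
  apply: (not_disk_like_separated R _ 5%N isT T TE Tc _ (height_bound_45 R true)
    (farther 3%N) (farther_opp 3%N) hfar false 2%N 1%N 6%N); by vm_compute.
apply: (not_disk_like_separated R _ 5%N isT T TE Tc _ (height_bound_45 R false)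
  (farther 3%N) (farther_opp 3%N) hfar true 1%N 1%N 6%N); by vm_compute.
Qed.

Lemma not_disk_like_55 (R : realType) (sg : bool) (T : set (R * R)) :
  compact T -> tile_equation ((-1) ^+ sg * 5%:Z) 5%:Z T -> ~ disk_like T.
Proof.
move=> Tc TE.
have hC : (5%:R - 5%:R + 1)^-1 * (5%:R - 1) < 4%:R + 1 :> R.
  by rewrite subrr add0r invr1; lra.
have hfar y := farther_height R 4%N _ y hC.
have hb (s : bool) : height_bound R ((-1) ^+ s * 5%:Z) 5%N (5%:R - 5%:R + 1)^-1.
  exact: height_bound_real.
case: sg TE => TE.
  apply: (not_disk_like_separated R _ 5%N isT T TE Tc _ (hb true) (farther 4%N)
    (farther_opp 4%N) hfar false 2%N 1%N 6%N); by vm_compute.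
apply: (not_disk_like_separated R _ 5%N isT T TE Tc _ (hb false) (farther 4%N)
  (farther_opp 4%N) hfar true 2%N 1%N 6%N); by vm_compute.
Qed.

Lemma not_disk_like_57 (R : realType) (sg : bool) (T : set (R * R)) :
  compact T -> tile_equation ((-1) ^+ sg * 5%:Z) 7%:Z T -> ~ disk_like T.
Proof.
move=> Tc TE.
have hC : 6 / 13 * (7%:R - 1) < 2%:R + 1 :> R by lra.
have hfar y := farther_height R 2%N _ y hC.
case: sg TE => TE.
  apply: (not_disk_like_separated R _ 7%N isT T TE Tc _ (height_bound_57 R true)
    (farther 2%N) (farther_opp 2%N) hfar false 2%N 1%N 6%N); by vm_compute.
apply: (not_disk_like_separated R _ 7%N isT T TE Tc _ (height_bound_57 R false)
  (farther 2%N) (farther_opp 2%N) hfar true 2%N 1%N 6%N); by vm_compute.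
Qed.

(** * Large parameters *)

Section LargeDigits.
Context (R : realType) (sg : bool) (a b : nat) (T : set (R * R)).
Context (b6 : (6 <= b)%N) (ab : (a <= b)%N) (b3a : (b + 3 <= 2 * a)%N)
  (disc : (4 * b <= a ^ 2)%N).
Local Notation A := ((-1) ^+ sg * a%:Z).
Local Notation E := (@expand R A b).
Context (TE : tile_equation A b%:Z T) (Tc : compact T).

Let b1 : (1 < b)%N. Proof. by move: b6; lia. Qed.
Let b0 : (0 < b)%N. Proof. exact: ltnW. Qed.
Let hb : height_bound R A b (b%:R - a%:R + 1)^-1.
Proof. by apply: height_bound_real; lia. Qed.
Let TP p := tileP R A b b0 T p b1 TE.

Definition meeting (st : int * int * int) : Prop :=
  exists p q, [/\ signed st, T p, T q & related st p q].

Let AE : A = if sg then - a%:Z else a%:Z.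
Proof. by rewrite mulr_sign. Qed.

Lemma meeting_height s x y : meeting (s, x, y) ->
  (b%:Z - a%:Z + 1) * `|y| <= b%:Z - 1.
Proof.
move=> [p [q [sst Tp Tq rpq]]].
have := related_height R A b b1 T TE Tc _ hb _ _ _ sst Tp Tq rpq.
have t0 : 0 < b%:R - a%:R + 1 :> R.
  by have : a%:R <= b%:R :> R by [rewrite ler_nat]; lra.
rewrite /= mulrC ler_pdivlMr // -(ler_int R) mulrC => h.
by rewrite !(rmorphM, rmorphD, rmorphN) /= intr_norm mulr1z.
Qed.

Lemma meeting_child st : meeting st ->
  exists i j, [/\ (i < b)%N, (j < b)%N & meeting (child A b st i j)].
Proof.
move=> [p [q [sst Tp Tq rpq]]].
have [i [j [ib jb Ti Tj rij]]] := related_step R A b T TP _ _ _ sst Tp Tq rpq.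
exists i, j; split => //; exists (E i p), (E j q); split => //; exact: signed_child.
Qed.

Lemma meeting_next s x y : meeting (s, x, y) ->
  (b%:Z - a%:Z + 1) * `|x - A * y| <= b%:Z - 1.
Proof.
move=> /meeting_child[i [j [_ _ /meeting_height]]].
by rewrite normrM; case: (digit_signP b i) => ->; rewrite ?normrN normr1 mul1r.
Qed.

Lemma meeting_next2 s x y : meeting (s, x, y) -> exists2 e : int, `|e| <= b%:Z - 1 &
  (b%:Z - a%:Z + 1) * `|- (b%:Z * y) + e - A * (x - A * y)| <= b%:Z - 1.
Proof.
move=> mst; have [p [q [sst _ _ _]]] := mst; have [i [j [ib jb]]] := meeting_child _ mst.
move=> /meeting_next.
set u := - (b%:Z * y) + (if s == 1 then 0 else b%:Z - 1); set v := x - A * y => h.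
exists ((if s == 1 then 0 else b%:Z - 1) + s * digit_shift b j - digit_shift b i).
  move: sst; rewrite /signed /= /digit_shift => /orP[/eqP ->|/eqP ->] /=;
    by case: ifP => ?; case: ifP => ?; move: b6; lia.
rewrite mulrCA -mulrBr normrM (_ : `|digit_sign b i| = 1) ?mul1r in h; last first.
  by case: (digit_signP b i) => ->.
by move: h; rewrite /u !addrA.
Qed.

(** Two steps later the height is at least [a |q| - (b - 1)] in size, too much since [t = b - a]
    satisfies [t + 3 <= a]. *)
Lemma not_meeting_flat s q : (2 <= `|q|) -> ~ meeting (s, q, 0).
Proof.
move=> q2 /meeting_next2[e eb].
rewrite mulr0 oppr0 add0r mulr0 subr0 AE => h.
have h2 : a%:Z * `|q| - (b%:Z - 1) <= `|e - (if sg then - a%:Z else a%:Z) * q|.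
  have : a%:Z * `|q| = `|(if sg then - a%:Z else a%:Z) * q|.
    by case: (sg); rewrite normrM ?normrN.
  by lia.
have h3 : 2 * a%:Z - (b%:Z - 1) <= a%:Z * `|q| - (b%:Z - 1).
  by rewrite lerB // mulrC ler_wpM2l.
set t := b%:Z - a%:Z; have tE : b%:Z = a%:Z + t by rewrite /t; lia.
have t0 : 0 <= t by rewrite /t; lia.
have at3 : t + 3 <= a%:Z by rewrite /t; lia.
have : 0 <= t * (a%:Z - t - 1) by rewrite mulr_ge0 //; lia.
have : (t + 1) * (2 * a%:Z - (b%:Z - 1)) <= b%:Z - 1.
  by apply: le_trans h; rewrite ler_wpM2l; lia.
rewrite tE; lia.
Qed.

(* Both [|a - sg x|] and the next height [a (a - sg x) - 2 b + 1] would have to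
   respect [meeting_height]. *)
Lemma meeting_unit s x y (u := a%:Z - (-1) ^+ sg * x * y) :
  `|y| = 1 -> 0 <= u -> meeting (s, x, y) ->
  (b%:Z - a%:Z + 1) * u <= b%:Z - 1 /\
  (b%:Z - a%:Z + 1) * (a%:Z * u - 2 * b%:Z + 1) <= b%:Z - 1.
Proof.
move=> y1 u0 m.
have t0 : 0 <= b%:Z - a%:Z + 1 by lia.
have yE : y = 1 \/ y = -1 by lia.
split.
  apply: le_trans (meeting_next _ _ _ m); rewrite ler_wpM2l //.
  by rewrite /u AE; case: (sg) yE => -[->|->]; rewrite ?expr1 ?expr0; lia.
have [e eb h] := meeting_next2 _ _ _ m.
apply: le_trans h; rewrite ler_wpM2l //.
have -> : A * (x - A * y) = - (a%:Z * u * y).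
  by rewrite /u AE; case: (sg) yE => -[->|->]; rewrite ?expr1 ?expr0; ring.
by case: yE => ->; lia.
Qed.

(** With [t = b - a], the hypothesis gives [2 u >= a - t + 2] for [u = a - z]. This breaks the
    second bound of [meeting_unit] if [t = 0], the first if [t >= 1]. *)
Lemma not_meeting_low s x y : `|y| = 1 ->
  2 * ((-1) ^+ sg * x * y) <= b%:Z - 2 -> ~ meeting (s, x, y).
Proof.
move=> y1; set z := _ * x * y => hz m.
have u0 : 0 <= a%:Z - z by lia.
have [h1 h2] := meeting_unit _ _ _ y1 u0 m.
rewrite -/z in h1 h2; move: h1 h2; set u := a%:Z - z => h1 h2.
set t := b%:Z - a%:Z in h1 h2 *; have tE : b%:Z = a%:Z + t by rewrite /t; lia.
have t0 : 0 <= t by rewrite /t; lia.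
have at3 : t + 3 <= a%:Z by rewrite /t; lia.
have hu : a%:Z - t + 2 <= 2 * u by rewrite /u; lia.
have [t1|t1] : t = 0 \/ 1 <= t by lia.
  have : b%:Z * u <= 3 * b%:Z - 2 by move: h2; rewrite tE t1; lia.
  by nia.
have : 0 <= (a%:Z - t - 3) * (t - 1) by rewrite mulr_ge0; lia.
have : (t + 1) * (a%:Z - t + 2) <= 2 * (b%:Z - 1).
  have : (t + 1) * (a%:Z - t + 2) <= (t + 1) * (2 * u) by rewrite ler_wpM2l; lia.
  by lia.
rewrite tE; lia.
Qed.

(** Just above the range of [not_meeting_low], a strict inequality still breaks a bound of
    [meeting_unit]: the second if [t <= 1], the first if [t >= 2]. *)
Lemma not_meeting_mid s x y : `|y| = 1 -> (b + 3 < 2 * a)%N ->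
  2 * ((-1) ^+ sg * x * y) = b%:Z - 1 -> ~ meeting (s, x, y).
Proof.
move=> y1 ba; set z := _ * x * y => hz m.
have u0 : 0 <= a%:Z - z by lia.
have [h1 h2] := meeting_unit _ _ _ y1 u0 m.
rewrite -/z in h1 h2; move: h1 h2; set u := a%:Z - z => h1 h2.
set t := b%:Z - a%:Z in h1 h2 *; have tE : b%:Z = a%:Z + t by rewrite /t; lia.
have t0 : 0 <= t by rewrite /t; lia.
have at3 : t + 3 < a%:Z by rewrite /t; lia.
have hu : a%:Z - t + 1 = 2 * u by rewrite /u; lia.
have [t1|[t1|t1]] : t = 0 \/ t = 1 \/ 2 <= t by lia.
- have : b%:Z * u <= 3 * b%:Z - 2 by move: h2; rewrite tE t1; lia.
  by nia.
- rewrite t1 in h2; have : 2 * (a%:Z * u) <= 5 * b%:Z - 3 by lia.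
  have : a%:Z = 2 * u by lia.
  move=> e; rewrite tE t1 e => h; have : 3 <= u by lia.
  by nia.
- have : 0 < (a%:Z - t - 3) * (t - 1) by rewrite mulr_gt0; lia.
  have : (t + 1) * (a%:Z - t + 1) <= 2 * (b%:Z - 1) by rewrite hu; lia.
  by rewrite tE; lia.
Qed.

(** The bound now reads [(a - 2) |y| <= 2 (a - 2)], so 2 is the extremal height. Respecting it for
    two more steps forces [w <= 2] and [w > 1], which fixes [x]. *)
Lemma meeting_two s x y : (b + 3 = 2 * a)%N -> `|y| = 2 -> meeting (s, x, y) ->
  x * 2 = (-1) ^+ sg * (b%:Z + 1) * y.
Proof.
move=> ba y2 m.
have a5 : (5 <= a)%N by move: disc b6; nia.
have small (z : int) : (b%:Z - a%:Z + 1) * `|z| <= b%:Z - 1 -> `|z| <= 2.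
  have -> : b%:Z - a%:Z + 1 = a%:Z - 2 by lia.
  have -> : b%:Z - 1 = (a%:Z - 2) * 2 by lia.
  by rewrite ler_pM2l //; lia.
have h1 := small _ (meeting_next _ _ _ m).
have [e eb /small h2] := meeting_next2 _ _ _ m.
have [ka [kaP yE]] : exists ka : int, (ka = 1 \/ ka = -1) /\ y = 2 * ka.
  have [->|->] : y = 2 \/ y = -2 by lia.
    by exists 1; split; [left|].
  by exists (-1); split; [right|].
pose w := 2 * a%:Z - (-1) ^+ sg * ka * x.
have xE : x - A * y = - ((-1) ^+ sg * ka * w).
  by rewrite yE /w AE; case: (sg) kaP => -[->|->]; rewrite ?expr1 ?expr0; ring.
have w2 : `|w| <= 2.
  by move: h1; rewrite xE; case: (sg) kaP => -[->|->]; rewrite ?expr1 ?expr0; lia.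
have h3 : `|- (2 * b%:Z) + ka * e + a%:Z * w| <= 2.
  move: h2; rewrite xE yE AE; case: (sg) kaP => -[->|->]; rewrite ?expr1 ?expr0; lia.
have hw : w = 2.
  have [w1|] : w <= 1 \/ w = 2 by lia.
    have : a%:Z * w <= a%:Z * 1 by rewrite ler_wpM2l.
    by case: kaP h3 => ->; lia.
  by [].
move: hw; rewrite /w yE; case: (sg) kaP => -[->|->]; rewrite ?expr1 ?expr0; lia.
Qed.

(* In the borderline case [B + 3 = 2 |A|] the height of every state met from here on
   is extremal, which forces all digits. *)
Lemma meeting_top x i j p q : (b + 3 = 2 * a)%N -> (-1) ^+ sg * x = a%:Z - 2 ->
  T p -> T q -> related (1, x, 1) p q -> (i < b)%N -> (j < b)%N ->
  T (E i p) -> T (E j q) -> [/\ sg, i = 1%N & j = b.-1].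
Proof.
move=> ba hx Tp Tq rpq ib jb Ti Tj.
have m1 : meeting (child A b (1, x, 1) i j).
  exists (E i p), (E j q); split => //; first exact: signed_child.
  exact: related_child.
have [i2 [j2 [ib2 jb2 m2]]] := meeting_child _ m1.
(* The first child has height 2 in size, so [meeting_two] applies; the equation it yields gives the
   second child height 2 as well, and [meeting_two] applies again. *)
have xE : x - A * 1 = - (2 * (-1) ^+ sg).
  by move: hx; rewrite AE; case: (sg); rewrite ?expr1 ?expr0; lia.
rewrite /child xE in m1 m2.
have h1 : digit_shift b i = digit_shift b j + 1.
  have := meeting_two _ _ _ ba _ m1.
  rewrite normrM normrN normrM normr_sign (_ : `|digit_sign b i| = 1); last first.
    by case: (digit_signP b i) => ->.
  move=> /(_ (erefl _)); rewrite eqxx.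
  by case: (digit_signP b i) => ->; case: (sg); rewrite ?expr1 ?expr0; lia.
have bi : (i < b.-1)%N.
  by move: h1; rewrite /digit_shift; case: ifP => //; case: ifP; lia.
have si : digit_sign b i = 1 by rewrite /digit_sign bi.
have yE : digit_sign b i2 *
    (digit_sign b i * (- (b%:Z * 1) + (if 1 == 1 :> int then 0 else b%:Z - 1) +
      1 * digit_shift b j - digit_shift b i) -
     A * (digit_sign b i * - (2 * (-1) ^+ sg))) = 2 * digit_sign b i2.
  by rewrite si h1 AE eqxx; case: (sg); rewrite ?expr1 ?expr0; lia.
rewrite yE in m2.
have h2 : 2 * b%:Z * (-1) ^+ sg + (if digit_sign b j == 1 then 0 else b%:Z - 1)
    + digit_sign b j * digit_shift b j2 - digit_shift b i2 = (-1) ^+ sg * (b%:Z + 1).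
  have := meeting_two _ _ _ ba _ m2.
  rewrite normrM (_ : `|digit_sign b i2| = 1); last first.
    by case: (digit_signP b i2) => ->.
  move=> /(_ (erefl _)); rewrite si !mul1r.
  by case: (digit_signP b i2) => ->; case: (sg); rewrite ?expr1 ?expr0; lia.
have sh n : 0 <= digit_shift b n <= b%:Z - 2.
  by rewrite /digit_shift; case: ifP; move: b6; lia.
have := sh i2; have := sh j2 => s1 s2.
(* If [j] were not the rotation, two shifts in [[0, b - 2]] would differ by [b - 1]. *)
have [bj|bj] := ltnP j b.-1.
  by move: h2; rewrite /digit_sign bj eqxx; case: (sg); rewrite ?expr1 ?expr0; lia.
have jE : j = b.-1 by lia.
move: h2; rewrite /digit_sign ltnNge bj /=; case: (sg); rewrite ?expr1 ?expr0 => h2.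
  split => //; move: h1; rewrite /digit_shift bi ltnNge bj /=; lia.
exfalso; lia.
Qed.

Let s1 x y : signed (1, x, y). Proof. by []. Qed.

Lemma child_flat i j d :
  child A b (1, d, 0) i j =
  (digit_sign b i * digit_sign b j,
   digit_sign b i * (digit_shift b j - digit_shift b i), digit_sign b i * d).
Proof. by rewrite /child /= !(mulr0, mulr1, mul1r, subr0, addr0, oppr0, add0r). Qed.

Lemma related_swap x y (p q : R * R) :
  related (1, x, y) p q -> related (1, - x, - y) q p.
Proof.
by move=> []; rewrite /related /= mulr1z !mul1r !rmorphN /= => -> ->; rewrite !addrK.
Qed.

(** The middle digit: shifts below [k] differ from it by at most [(b - 2) / 2], shifts above it by
    at most [(b - 1) / 2]. *)
Let k := (b./2).-1.
Let kb : (2 <= k)%N && (2 * k + 2 <= b <= 2 * k + 3)%N.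
Proof. by rewrite /k; move: b6; lia. Qed.
Let k0 : (k < b.-1)%N. Proof. by move: kb; lia. Qed.
Local Notation ev := (fun l => eventually_in R (E k) (side_seq R A b T (~~ sg) k l)).

Lemma meeting_of i j st p q : signed st -> related st p q -> T (E i p) -> T (E j q) ->
  meeting (child A b st i j).
Proof.
move=> sst rpq Ti Tj; exists (E i p), (E j q); split => //; first exact: signed_child.
exact: related_child.
Qed.

(** Two expansions of one point are related by a state of height 0, to which [not_meeting_flat]
    applies. *)
Lemma adjacent_digit i j pt : T (E i pt) -> T (E j pt) ->
  `|digit_shift b j - digit_shift b i| < 2.
Proof.
move=> Ti Tj; rewrite ltNge; apply/negP => h.
have := meeting_of i j (1, 0, 0) pt pt (s1 0 0) (related_refl R pt) Ti Tj.
rewrite child_flat mulr0; apply: not_meeting_flat.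
by rewrite normrM (_ : `|digit_sign b i| = 1) ?mul1r //; case: (digit_signP b i) => ->.
Qed.

Lemma unit_digits i j (d : int) p q : `|d| = 1 -> related (1, d, 0) p q ->
  T (E i p) -> T (E j q) ->
  ~ 2 * ((-1) ^+ sg * (digit_shift b j - digit_shift b i) * d) <= b%:Z - 2.
Proof.
move=> d1 rpq Ti Tj h; have := meeting_of i j _ _ _ (s1 d 0) rpq Ti Tj.
have s2 : digit_sign b i * digit_sign b i = 1 by case: (digit_signP b i) => ->.
rewrite child_flat; apply: not_meeting_low.
  by rewrite normrM d1 mulr1; case: (digit_signP b i) => ->.
rewrite [X in 2 * X](_ : _ = (digit_sign b i * digit_sign b i) *
  ((-1) ^+ sg * (digit_shift b j - digit_shift b i) * d)); last by ring.
by rewrite s2 mul1r.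
Qed.

(** By [adjacent_digit], a common point has [k] as one first digit and a neighbour of [k] as the
    other. One expansion later [unit_digits] requires shifts at least [(b - 1) / 2] apart in a
    prescribed direction; the central position of [k] leaves only equality, hence [b + 3 = 2 a], and
    [meeting_top] then gives a contradiction. *)
Lemma sides_disjoint l : side R A b T k l `&` ev (~~ l) = set0.
Proof.
apply/seteqP; split => // pt [[i /andP[ib il] Ti] /ev_step evpt].
case: evpt => [[j /andP[jb jl] Tj]|evk].
  have := adjacent_digit i j pt Ti Tj.
  move: il jl kb; rewrite /on_side /digit_shift; case: (l) => /=;
    case: ifP; case: ifP; lia.
have Tk : T (E k pt) by exact: (ev_in R A b b0 T TP _ k k0 _ _ evk).
have {}ib : (i < b.-1)%N && ((l && (i.+1 == k)) || (~~ l && (i == k.+1))).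
  have := adjacent_digit i k pt Ti Tk; move: il kb; rewrite /on_side /digit_shift k0.
  by case: (l) => /=; case: ifP; lia.
pose d := k%:Z - i%:Z.
have d1 : `|d| = 1 by rewrite /d; move: ib; case: (l); lia.
have rpq : related (1, d, 0) (E i pt) (E k pt).
  have := related_child R A b i k _ _ _ (s1 0 0) (related_refl R pt).
  case/andP: ib => bi _.
  by rewrite child_flat /digit_sign /digit_shift k0 bi mulr1 !mul1r.
set p := E i pt in Ti rpq; set q := E k pt in Tk rpq evk.
have [i2 ib2 Ti2] := (TP p).1 Ti.
have sh n : 0 <= digit_shift b n <= b%:Z - 2 by rewrite /digit_shift; case: ifP; lia.
have key j : (on_side b k (~~ l (+) ~~ sg) j || (j == k)) -> (j < b)%N -> T (E j q) ->
    [/\ 2 * ((-1) ^+ sg * (digit_shift b j - digit_shift b i2) * d) = b%:Z - 1,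
        (i2 < b.-1)%N, (j < b.-1)%N, l = sg & (sg ==> (j == k))].
  move=> jl jb Tj; have := unit_digits i2 j d p q d1 rpq Ti2 Tj.
  have := sh i2; have := sh j; move: ib jl kb k0; rewrite /on_side /d /digit_shift.
  case: (l); case: (sg); rewrite ?expr1 ?expr0 /=; case: (ltnP i2 b.-1);
    case: (ltnP j b.-1); intros; split; lia.
have far2a j : 2 * ((-1) ^+ sg * (digit_shift b j - digit_shift b i2) * d) = b%:Z - 1 ->
    T (E j q) -> (i2 < b.-1)%N -> (b + 3 = 2 * a)%N.
  move=> h Tj bi2; have [//|ba] : (b + 3 = 2 * a)%N \/ (b + 3 < 2 * a)%N by lia.
  have := meeting_of i2 j _ _ _ (s1 d 0) rpq Ti2 Tj.
  rewrite child_flat /digit_sign bi2 !mul1r => m.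
  by exfalso; apply: (not_meeting_mid _ _ _ d1 ba h m).
have fin j : (on_side b k (~~ l (+) ~~ sg) j || (j == k)) -> (j < b)%N -> T (E j q) ->
    (j = k -> ev (~~ l (+) ~~ sg (+) ~~ sg) (E j q)) -> False.
  move=> jl jb Tj evj; have [h bi2 bj ls jk] := key _ jl jb Tj.
  have ba := far2a _ h Tj bi2.
  have := related_child R A b i2 j _ _ _ (s1 d 0) rpq.
  have [si2 sj] : digit_sign b i2 = 1 /\ digit_sign b j = 1.
    by rewrite /digit_sign bi2 bj.
  rewrite child_flat si2 sj !mul1r => r2.
  move: ib; rewrite ls; case: (boolP sg) => hs /= ib.
    have jE : j = k by move: jk; rewrite hs => /eqP.
    have dE : d = 1 by rewrite /d; lia.
    move: (evj jE) => /ev_step evq.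
    (* The next digit of [q] is [k] or above it but not the rotation, whereas [meeting_top] requires
       the rotation. *)
    have [j3 j3b Tj3] : exists2 j3, (j3 < b.-1)%N & T (E j3 (E j q)).
      case: evq => [[j3 /andP[j3b j3l] Tj3]|evq].
        by exists j3 => //; move: j3l; rewrite ls hs /on_side /=; lia.
      by exists k => //; exact: (ev_in R A b b0 T TP _ k k0 _ _ evq).
    have [i3 ib3 Ti3] := (TP _).1 Ti2.
    rewrite dE in r2 h.
    have hx : (-1) ^+ sg * (digit_shift b j - digit_shift b i2) = a%:Z - 2 by lia.
    have j3b' := leq_trans j3b (leq_pred b).
    have [_ _ e3] := meeting_top _ i3 j3 _ _ ba hx Ti2 Tj r2 ib3 j3b' Ti3 Tj3.
    by move: j3b; rewrite e3 ltnn.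
  have dE : d = -1 by rewrite /d; lia.
  have [i3 ib3 Ti3] := (TP _).1 Ti2.
  have [j3 jb3 Tj3] := (TP _).1 Tj.
  rewrite dE in r2 h; have r3 := related_swap _ _ _ _ r2; rewrite opprK in r3.
  have hx : (-1) ^+ sg * - (digit_shift b j - digit_shift b i2) = a%:Z - 2.
    by move: h; rewrite (negbTE hs) expr0; lia.
  have [hs' _ _] := meeting_top _ j3 i3 _ _ ba hx Tj Ti2 r3 jb3 ib3 Tj3 Ti3.
  by rewrite hs' in hs.
have [[j /andP[jb jl] Tj]|evkk] := ev_step R A b T _ k _ _ evk.
  apply: (fin j) => //; first by rewrite jl.
  by move=> jk; move: jl; rewrite jk /on_side; case: (_ (+) _) => /=; move: k0; lia.
apply: (fin k); rewrite ?eqxx ?orbT //; first exact: leq_trans k0 (leq_pred _).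
exact: (ev_in R A b b0 T TP _ k k0 _ _ evkk).
Qed.

Theorem not_disk_like_large : ~ disk_like T.
Proof.
move=> dT; have kb1 : (k.+1 < b.-1)%N by move: kb; lia.
have fv j p q := tile_forever R A b T Tc _ hb j p q.
apply: (not_disk_of_separated R A b b0 T TP fv (~~ sg) k k0 (closed_tile R T Tc) dT kb1).
by move=> l; rewrite sides_disjoint; exact: countable0.
Qed.

End LargeDigits.

Lemma small_parameters (a b : nat) : (a <= b)%N -> (b + 3 <= 2 * a)%N ->
  ~~ ((6 <= b)%N && (4 * b <= a ^ 2)%N) ->
  (a, b) \in [:: (3, 3); (4, 4); (4, 5); (5, 5); (5, 7)]%N.
Proof.
move=> ab b3a h.
(* For [b >= 9], [4 a^2 >= (b + 3)^2 >= 16 b], as [(b - 1) (b - 9) >= 0]. *)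
have b8 : (b <= 8)%N.
  by rewrite leqNgt; apply/negP => b9; move: h; rewrite (leq_trans _ b9) //=; nia.
have a8 : (a <= 8)%N by lia.
move: ab b3a h; rewrite -(ltnS b) in b8; rewrite -(ltnS a) in a8.
by do 9?[case: a a8 => [|a] a8] => //; do 9?[case: b b8 => [|b] b8].
Qed.

Theorem theorem7p2 (R : realType) (A B : int)
  (hAB : `|A| <= B) (hAB3 : B + 3 <= 2 * `|A|)
  (T : set (R * R)) (hT0 : T !=set0) (hTc : compact T)
  (hTeq : tile_equation A B T) :
  ~ disk_like T.
Proof.
pose a := `|A|%N; pose b := `|B|%N.
have BE : B = b%:Z by rewrite /b; lia.
have [sg AE] : exists sg : bool, A = (-1) ^+ sg * a%:Z.
  by exists (A < 0); rewrite mulr_sign /a; case: ifP; lia.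
have ab : (a <= b)%N by rewrite /a /b; lia.
have b3a : (b + 3 <= 2 * a)%N by rewrite /a /b; lia.
rewrite AE BE in hTeq; move: a b ab b3a hTeq {AE BE} => a b ab b3a TE.
have [/andP[b6 disc]|small] := boolP ((6 <= b)%N && (4 * b <= a ^ 2)%N).
  exact: (not_disk_like_large R sg a b T b6 ab b3a disc TE hTc).
have := small_parameters a b ab b3a small; rewrite !inE.
move=> /orP[/eqP[aE bE]|/orP[/eqP[aE bE]|/orP[/eqP[aE bE]|/orP[/eqP[aE bE]|/eqP[aE bE]]]]];
  rewrite aE bE in TE.
- exact: not_disk_like_33 hTc TE.
- exact: not_disk_like_44 hTc TE.
- exact: not_disk_like_45 hTc TE.
- exact: not_disk_like_55 hTc TE.
- exact: not_disk_like_57 hTc TE.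
Qed.
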